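(* Let $F$ be a closed relation on a compact metric space $X$, let $C$ be a closed subset of $X$ and let $U$ be an open subset of $X$ with $U \subset C$. (a) Assume $C$ is an isolating neighborhood for $F$ with $C_{\pm} \subset U$. There exists $\epsilon > 0$ so that if $F_1$ is a closed relation contained in $V_{\epsilon} \circ F \circ V_{\epsilon}$, then $C$ is an isolating neighborhood for $F_1$ with the associated viable set $C_{\pm}$ for $F_1$ contained in $U$. (b) Assume $C$ is a $-$ isolating neighborhood for $F$ with $C_{-} \subset U$ (or a $+$ isolating neighborhood with $C_{+} \subset U$). There exists $\epsilon > 0$ so that if $F_1$ is a closed relation contained in $V_{\epsilon} \circ F \circ V_{\epsilon}$, then $C$ is a $-$ isolating neighborhood for $F_1$ with the associated $-$ viable set $C_{-}$ for $F_1$ contained in $U$ (respectively, $C$ is a $+$ isolating neighborhood for $F_1$ with the associated $+$ viable set $C_{+}$ for $F_1$ contained in $U$).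
   Context: A relation $F$ on $X$ is a subset of $X\times X$, closed if it is a closed subset; $F(A)=\{y:(x,y)\in F \text{ for some } x\in A\}$, $F^{-1}=\{(y,x):(x,y)\in F\}$, $G\circ F=\{(x,z): \exists y,\ (x,y)\in F, (y,z)\in G\}$; $F^n$ is the $n$-fold composition, $F^{-n}=(F^{-1})^n$. $V_\epsilon=\{(x,y)\in X\times X:d(x,y)<\epsilon\}$. $C^\circ$ is the interior of $C$ in $X$. For a closed relation $F$ and closed $C$: $F_C=F\cap(C\times C)$; $C_-=\bigcap_{n\ge1}(F_C)^n(C)$, $C_+=\bigcap_{n\ge1}(F_C)^{-n}(C)$, $C_\pm=C_+\cap C_-$ (all depending on $F$). $C$ is an isolating neighborhood for $F$ if $C_\pm\subset C^\circ$, a $-$ isolating neighborhood if $C_-\subset C^\circ$, and a $+$ isolating neighborhood if $C_+\subset C^\circ$. The sets $C_\pm$, $C_-$, $C_+$ are then the associated viable, $-$ viable, $+$ viable sets. *)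

(* Defs.v *)
From mathcomp Require Import all_boot all_order all_algebra.
From mathcomp Require Import all_classical all_reals all_analysis.

Set Implicit Arguments.
Unset Strict Implicit.
Unset Printing Implicit Defensive.

Local Open Scope classical_set_scope.
Local Open Scope relation_scope.

Section Relations.
Context {T : Type}.
Implicit Types (F : set (T * T)) (A C : set T).

Definition rel_image F A : set T := [set y | exists2 x, A x & F (x, y)].

(* [G \; F] is the library's [G] after [F]: it relates x to z when there is y
   with [F (x, y)] and [G (y, z)]. *)
Definition rel_iter F (n : nat) : set (T * T) :=
  iter n (fun G => F \; G) diagonal.

Definition rel_restr F C : set (T * T) := F `&` (C `*` C).

Definition viable_minus F C : set T :=
  \bigcap_(n in [set n : nat | 1 <= n]) rel_image (rel_iter (rel_restr F C) n) C.

Definition viable_plus F C : set T :=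
  \bigcap_(n in [set n : nat | 1 <= n])
    rel_image (rel_iter ((rel_restr F C)^-1) n) C.

Definition viable_pm F C : set T := viable_plus F C `&` viable_minus F C.

End Relations.

(* These notions are only meant for a closed relation [F] and a closed set
   [C]; closedness is assumed separately where they are used. *)
Section IsolatingNeighborhoods.
Context {X : topologicalType}.
Implicit Types (F : set (X * X)) (C : set X).

Definition isolating_nbhd F C : Prop := viable_pm F C `<=` C°.

Definition minus_isolating_nbhd F C : Prop := viable_minus F C `<=` C°.

Definition plus_isolating_nbhd F C : Prop := viable_plus F C `<=` C°.

End IsolatingNeighborhoods.

Definition mdist_entourage {R : realType} {X : metricType R} (e : R) :
  set (X * X) := [set xy | (mdist xy.1 xy.2 < e)%R].

(* Main.v *)
Require Import Defs.
From mathcomp Require Import all_boot all_order all_algebra.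
From mathcomp Require Import all_classical all_reals all_analysis.
From mathcomp Require Import lra.

(** All three parts say that a set built from the relation, which lies in [U]
    for [F], still lies in [U] for every relation close to [F].  This is the
    upper semicontinuity of the viable sets, which comes from the compactness
    of the space and the closedness of [F] and [C].

    Upper semicontinuity is expressed by [limsup_sub G S S0]: along the filter
    [G], the sets [S i] accumulate only at points of [S0], that is, their
    Kuratowski upper limit is contained in [S0].  In a compact space, if
    [S0] lies in an open set [U], then [S i] lies in [U] for [i] near [G]
    ([limsup_sub_near]).  So it is enough to show that the viable sets of [F1]
    accumulate only at the viable set of [F] when [F1] runs along the filter
    [vnbhs F], whose basic sets consist of the relations contained in
    [V_e \; F \; V_e].

    The viable sets are obtained by preimages under continuous maps, arbitrary
    intersections and compositions of relations, and each of these operations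
    preserves [limsup_sub].  Only composition is not immediate: when
    the intermediate space is compact, finitely many neighbourhoods of possible
    intermediate points exclude all of them at once ([limsup_sub_compose]).
    The composition lemma also shows that [V_e \; F \; V_e] accumulates only at
    [diagonal \; F \; diagonal = F] as [e] tends to 0, hence that [F1]
    accumulates only at [F] along [vnbhs F].

    Finally, since [U] is open and contained in [C], a set contained in
    [U] is automatically contained in the interior of [C]. *)

Set Implicit Arguments.
Unset Strict Implicit.
Unset Printing Implicit Defensive.

Import Order.TTheory GRing.Theory Num.Theory.

Local Open Scope classical_set_scope.
Local Open Scope relation_scope.

(** * Upper limits of families of sets *)

Definition limsup_sub {I : Type} {T : topologicalType} (G : set_system I)
    (S : I -> set T) (S0 : set T) : Prop :=
  forall x, ~ S0 x -> \forall x' \near x & i \near G, ~ S i x'.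

Section UpperLimits.
Context {I : Type} (G : set_system I) {FG : Filter G}.

Lemma limsup_sub_cst (T : topologicalType) (A : set T) :
  closed A -> limsup_sub G (fun=> A) A.
Proof.
move=> clA x nAx; exists (~` A, setT) => [|[y i] [] //].
split; last exact: filterT.
by apply: open_nbhs_nbhs; split=> //; exact: closed_openC.
Qed.

Lemma limsup_sub_preimage (T T' : topologicalType) (f : T -> T')
    (S : I -> set T') (S0 : set T') :
  continuous f -> limsup_sub G S S0 ->
  limsup_sub G (fun i => f @^-1` S i) (f @^-1` S0).
Proof.
move=> cf limS x /limS [[/= P Q] [Pfx GQ] PQ].
exists (f @^-1` P, Q) => [|[y i] [Py Qi]]; first by split=> //; exact: cf.
exact: (PQ (f y, i)).
Qed.

Lemma limsup_sub_bigcap (T : topologicalType) (J : Type) (D : set J)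
    (S : J -> I -> set T) (S0 : J -> set T) :
  (forall j, D j -> limsup_sub G (S j) (S0 j)) ->
  limsup_sub G (fun i => \bigcap_(j in D) S j i) (\bigcap_(j in D) S0 j).
Proof.
move=> limS x /existsNP[j /not_implyP[Dj /(limS _ Dj)]].
by apply: filterS => -[y i] /= nSy /(_ j Dj).
Qed.

Lemma limsup_sub_setI (T : topologicalType) (S S' : I -> set T)
    (S0 S0' : set T) :
  limsup_sub G S S0 -> limsup_sub G S' S0' ->
  limsup_sub G (fun i => S i `&` S' i) (S0 `&` S0').
Proof.
move=> limS limS' x /not_andP[/limS|/limS']; by apply: filterS => -[y i] /= nSy [].
Qed.

(** Let [(x, z)] lie outside [B0 \; A0].  Each candidate intermediate point
    [y] fails one of the two limit relations, so the points near [y] are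
    excluded as intermediate points between ends near [x] and [z], for indices
    near [G]; compactness makes this uniform in [y].  The covering property is
    applied to the product of [nbhs (x, z)] and [G], so that the ends and the
    index vary together. *)
Lemma limsup_sub_compose (X Y Z : topologicalType) (A : I -> set (X * Y))
    (B : I -> set (Y * Z)) (A0 : set (X * Y)) (B0 : set (Y * Z)) :
  compact [set: Y] -> limsup_sub G A A0 -> limsup_sub G B B0 ->
  limsup_sub G (fun i => B i \; A i) (B0 \; A0).
Proof.
move=> /compact_near_coveringP cY limA limB [x z] nAB.
pose P (wi : (X * Z) * I) y := ~ (A wi.2 (wi.1.1, y) /\ B wi.2 (y, wi.1.2)).
have nearP y : [set: Y] y ->
    \forall y' \near y & wi \near filter_prod (nbhs (x, z)) G, P wi y'.
  move=> _; have [Axy|/limA] := pselect (A0 (x, y)).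
    have /limB : ~ B0 (y, z) by move=> Byz; apply: nAB; exists y.
    move=> [[/= N Q] [[[/= V W] [Vy Wz] VWN] GQ] NQ].
    exists (V, (setT `*` W) `*` Q) => /=.
      split=> //; exists (setT `*` W, Q) => //; split=> //.
      by exists (setT, W) => //; split=> //; exact: filterT.
    move=> [y' [[x' z'] i]] [/= Vy' [[_ Wz'] Qi]] [_].
    by apply: (NQ ((y', z'), i)); split=> //; exact: VWN.
  move=> [[/= N Q] [[[/= W V] [Wx Vy] WVN] GQ] NQ].
  exists (V, (W `*` setT) `*` Q) => /=.
    split=> //; exists (W `*` setT, Q) => //; split=> //.
    by exists (W, setT) => //; split=> //; exact: filterT.
  move=> [y' [[x' z'] i]] [/= Vy' [[Wx' _] Qi]] [+ _].
  by apply: (NQ ((x', y'), i)); split=> //; exact: WVN.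
apply: filterS (cY _ _ P _ nearP) => -[[x' z'] i] /= noY [y Axy Byz].
by apply: (noY y).
Qed.

(** Near a point of [U] there is nothing to prove, and near any other point
    the sets [S i] are eventually absent; compactness makes the index
    uniform. *)
Lemma limsup_sub_near (T : topologicalType) (S : I -> set T) (S0 U : set T) :
  compact [set: T] -> open U -> S0 `<=` U -> limsup_sub G S S0 ->
  \forall i \near G, S i `<=` U.
Proof.
move=> /compact_near_coveringP cT oU S0U limS.
have nearU x : [set: T] x ->
    \forall x' \near x & i \near G, S i x' -> U x'.
  move=> _; have [Ux|nUx] := pselect (U x).
    exists (U, setT) => [|[y i] [] //].
    by split; [exact: open_nbhs_nbhs | exact: filterT].
  have /limS : ~ S0 x by move=> /S0U.
  by apply: filterS => -[y i].
by apply: filterS (cT _ _ _ _ nearU) => i SU x; exact: SU.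
Qed.

End UpperLimits.

(** * Upper semicontinuity of the viable sets *)

Section ViableSets.
Context {I : Type} (G : set_system I) {FG : Filter G} {X : topologicalType}.
Variables (C : set X) (S : I -> set (X * X)) (F : set (X * X)).
Hypotheses (compactX : compact [set: X]) (closedC : closed C).
Hypothesis limS : limsup_sub G S F.

Let closed_fst : closed ((@fst X X) @^-1` C).
Proof. by apply: preimage_closed => // x _; exact: cvg_fst. Qed.

Let closed_snd : closed ((@snd X X) @^-1` C).
Proof. by apply: preimage_closed => // x _; exact: cvg_snd. Qed.

Lemma limsup_sub_inv (S' : I -> set (X * X)) (F' : set (X * X)) :
  limsup_sub G S' F' -> limsup_sub G (fun i => (S' i)^-1) F'^-1.
Proof.
apply: (@limsup_sub_preimage _ G _ _ (fun xy : X * X => (xy.2, xy.1))).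
by move=> xy; apply: cvg_pair; [exact: cvg_snd | exact: cvg_fst].
Qed.

Lemma limsup_sub_restr :
  limsup_sub G (fun i => rel_restr (S i) C) (rel_restr F C).
Proof.
apply: limsup_sub_setI => //; apply: limsup_sub_cst.
exact: closedI.
Qed.

Lemma limsup_sub_iter (S' : I -> set (X * X)) (F' : set (X * X)) n :
  limsup_sub G S' F' ->
  limsup_sub G (fun i => rel_iter (S' i) n.+1) (rel_iter F' n.+1).
Proof.
have iter1 (E : set (X * X)) : rel_iter E 1 = E.
  apply/seteqP; split=> [[x y] [z /diagonalP <-] //|[x y] Exy].
  by exists x.
(* Starting at [n = 1] keeps the diagonal, closed only in Hausdorff spaces, out
   of the induction. *)
move=> limS'; elim: n => [|n IHn].
  by under [fun _ => _]funext do rewrite iter1; rewrite iter1.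
exact: (limsup_sub_compose compactX IHn limS').
Qed.

(** The image of [C] under [E] is the preimage, under the diagonal embedding,
    of the relation [setT `*` C] followed by [E]; in this form only operations
    already known to preserve [limsup_sub] occur. *)
Lemma limsup_sub_image (S' : I -> set (X * X)) (F' : set (X * X)) :
  limsup_sub G S' F' ->
  limsup_sub G (fun i => rel_image (S' i) C) (rel_image F' C).
Proof.
have imageE (E : set (X * X)) :
    rel_image E C = (fun y => (y, y)) @^-1` (E \; (@snd X X @^-1` C)) by [].
move=> limS'; rewrite imageE; under [fun _ => _]funext do rewrite imageE.
apply: limsup_sub_preimage.
  by move=> x; apply: cvg_pair; exact: cvg_id.
exact: (limsup_sub_compose compactX (limsup_sub_cst closed_snd) limS').
Qed.

Lemma limsup_sub_viable_minus :
  limsup_sub G (fun i => viable_minus (S i) C) (viable_minus F C).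
Proof.
apply: limsup_sub_bigcap => -[//|n] _.
exact/limsup_sub_image/limsup_sub_iter/limsup_sub_restr.
Qed.

Lemma limsup_sub_viable_plus :
  limsup_sub G (fun i => viable_plus (S i) C) (viable_plus F C).
Proof.
apply: limsup_sub_bigcap => -[//|n] _.
exact/limsup_sub_image/limsup_sub_iter/(limsup_sub_inv limsup_sub_restr).
Qed.

Lemma limsup_sub_viable_pm :
  limsup_sub G (fun i => viable_pm (S i) C) (viable_pm F C).
Proof.
apply: limsup_sub_setI.
- exact: limsup_sub_viable_plus.
- exact: limsup_sub_viable_minus.
Qed.

End ViableSets.

(** * Relations close to a closed relation *)

Section VNeighbourhoods.
Context {R : realType} {X : metricType R}.
Implicit Types F : set (X * X).

(** The relations themselves serve as indices, so that a property holding near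
    this filter is exactly one for which a suitable [e] exists. *)
Definition vnbhs F : set_system (set (X * X)) :=
  filter_from [set e : R | (0 < e)%R]
    (fun e => [set F1 | F1 `<=` mdist_entourage e \; F \; mdist_entourage e]).

#[global] Instance vnbhs_filter F : Filter (vnbhs F).
Proof.
apply: filter_from_filter; first by exists 1%R => /=; exact: ltr01.
move=> d e d0 e0; exists (Num.min d e); first by rewrite /= lt_min d0.
have thicken_le (a b : R) : (a <= b)%R ->
    mdist_entourage a \; F \; mdist_entourage a `<=`
    mdist_entourage b \; F \; mdist_entourage b.
  move=> ab [x y] /= [v [u xu Fuv] vy].
  by exists v; [exists u => //; exact: lt_le_trans ab | exact: lt_le_trans ab].
move=> F1 F1V; split; apply: subset_trans F1V (thicken_le _ _ _).
- by rewrite ge_min lexx.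
- by rewrite ge_min lexx orbT.
Qed.

Lemma limsup_sub_mdist_entourage :
  limsup_sub (0^'+)%R (@mdist_entourage R X) diagonal.
Proof.
move=> [x y] /= /eqP; rewrite -mdist_gt0 => xy0.
pose d := (mdist x y / 3)%R.
have d0 : (0 < d)%R by rewrite divr_gt0.
exists (ball x d `*` ball y d, [set e | (e < d)%R]).
  split; last exact: nbhs_right_lt.
  by exists (ball x d, ball y d) => //; split; exact: nbhsx_ballx.
move=> [[x' y'] e] /= [[]]; rewrite !ballEmdist /= => xx' yy' ed.
(* Three distances less than [d] cannot add up to [mdist x y = 3 * d]. *)
rewrite /mdist_entourage /= => x'y'.
have := metric_triangle x x' y; have := metric_triangle x' y' y.
rewrite [mdist y' y]metric_sym.
have dE : mdist x y = (d * 3)%R by rewrite /d divfK.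
by lra.
Qed.

(** A relation in a basic set of [vnbhs F] misses every pair that the
    thickening [V_e \; F \; V_e] misses, so it is enough to treat the
    thickenings as [e] tends to 0. *)
Lemma limsup_sub_vnbhs F :
  compact [set: X] -> closed F -> limsup_sub (vnbhs F) id F.
Proof.
move=> cX clF xy nFxy.
have : limsup_sub (0^'+)%R
    (fun e : R => mdist_entourage e \; F \; mdist_entourage e)
    (diagonal \; F \; diagonal).
  have limV := limsup_sub_mdist_entourage.
  exact: (limsup_sub_compose cX
    (limsup_sub_compose cX limV (limsup_sub_cst clF)) limV).
move=> /(_ xy)[].
  case: xy nFxy => x y nFxy [v [u /= xu Fuv] vy].
  by apply: nFxy; rewrite (xu : x = u) -(vy : v = y).
move=> [/= N Q] [Nxy Q0] NQ.
have [e [Qe e0]] : exists e : R, Q e /\ (0 < e)%R.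
  apply: (@filter_ex _ (0^'+)%R).
  by apply: filterI; [exact: Q0 | exact: nbhs_right_gt].
exists (N, [set F1 | F1 `<=` mdist_entourage e \; F \; mdist_entourage e]).
  by split=> //; exists e.
by move=> [xy' F1] /= [Nxy' F1V] /F1V; exact: (NQ (xy', e)).
Qed.

Lemma vnbhs_sub (Phi : set (X * X) -> set X) F (C U : set X) :
  compact [set: X] -> open U -> U `<=` C ->
  limsup_sub (vnbhs F) Phi (Phi F) -> Phi F `<=` U ->
  exists2 e : R, (0 < e)%R &
    forall F1, closed F1 ->
      F1 `<=` mdist_entourage e \; F \; mdist_entourage e ->
      Phi F1 `<=` C° /\ Phi F1 `<=` U.
Proof.
move=> cX oU UC limPhi PhiU.
have [e e0 VU] := limsup_sub_near cX oU PhiU limPhi.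
exists e => // F1 _ /VU F1U; split=> //.
by apply: subset_trans F1U _; rewrite -open_subsetE.
Qed.

End VNeighbourhoods.

Theorem theorem2p45 (R : realType) (X : metricType R)
    (F : set (X * X)) (C U : set X)
    (compactX : compact [set: X]) (closedF : closed F)
    (closedC : closed C) (openU : open U) (subUC : U `<=` C) :
  (isolating_nbhd F C -> viable_pm F C `<=` U ->
    exists2 e : R, (0 < e)%R &
      forall F1 : set (X * X), closed F1 ->
        F1 `<=` mdist_entourage e \; F \; mdist_entourage e ->
        isolating_nbhd F1 C /\ viable_pm F1 C `<=` U) /\
  (minus_isolating_nbhd F C -> viable_minus F C `<=` U ->
    exists2 e : R, (0 < e)%R &
      forall F1 : set (X * X), closed F1 ->
        F1 `<=` mdist_entourage e \; F \; mdist_entourage e ->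
        minus_isolating_nbhd F1 C /\ viable_minus F1 C `<=` U) /\
  (plus_isolating_nbhd F C -> viable_plus F C `<=` U ->
    exists2 e : R, (0 < e)%R &
      forall F1 : set (X * X), closed F1 ->
        F1 `<=` mdist_entourage e \; F \; mdist_entourage e ->
        plus_isolating_nbhd F1 C /\ viable_plus F1 C `<=` U).
Proof.
have limF : limsup_sub (vnbhs F) id F by exact: limsup_sub_vnbhs.
split; [|split] => _ subU.
- apply: (vnbhs_sub (Phi := viable_pm^~ C)) => //.
  exact: limsup_sub_viable_pm limF.
- apply: (vnbhs_sub (Phi := viable_minus^~ C)) => //.
  exact: limsup_sub_viable_minus limF.
- apply: (vnbhs_sub (Phi := viable_plus^~ C)) => //.
  exact: limsup_sub_viable_plus limF.
Qed.
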